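(* Let $(z_n)_{n\ge 2}$ be integers with $z_2\ge 3$ and $z_n\ge 2$ for all $n\ge 3$, and define $x_1=1$ and $x_n=\prod_{j=2}^{n} z_j^{2^{n-j}}$ for $n\ge 2$. Let $$S=\sum_{j=1}^{\infty}\frac{1}{x_j}=1+\sum_{j=2}^{\infty}\frac{1}{z_2^{2^{j-2}}z_3^{2^{j-3}}\cdots z_j}.$$ For $n\ge 3$ put $\ell_n=3\cdot 2^{n-2}-1$ and define finite sequences $(a_j^{(n)})_{j=0}^{\ell_n-1}$ recursively by $$(a_0^{(3)},a_1^{(3)},a_2^{(3)},a_3^{(3)},a_4^{(3)})=(1,\ z_2-1,\ 1,\ z_3-1,\ z_2),$$ and for $n\ge3$: $a_j^{(n+1)}=a_j^{(n)}$ for $j=0,\ldots,\ell_n-1$; $a_{\ell_n}^{(n+1)}=z_{n+1}-1$, $a_{\ell_n+1}^{(n+1)}=1$, $a_{\ell_n+2}^{(n+1)}=a_{\ell_n-1}^{(n)}-1$; and $a_j^{(n+1)}=a_{2\ell_n-j+1}^{(n)}$ for $j=\ell_n+3,\ldots,2\ell_n$. For each $j\ge 0$ let $a_j=\lim_{n\to\infty}a_j^{(n)}$ (the sequence $a_j^{(n)}$ is eventually constant in $n$). Then $S$ has the (infinite, simple) continued fraction expansion $$S=[a_0;a_1,a_2,\ldots]=[1;\ z_2-1,\ 1,\ z_3-1,\ z_2,\ z_4-1,\ 1,\ \ldots].$$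
   Context: $[a_0;a_1,a_2,\ldots]$ denotes the infinite continued fraction $a_0+\cfrac{1}{a_1+\cfrac{1}{a_2+\cdots}}$, i.e. the limit of the finite continued fractions $[a_0;a_1,\ldots,a_m]$ as $m\to\infty$. *)

(* Defs.v *)
From HB Require Import structures.
From mathcomp Require Import all_boot all_order all_algebra.
From mathcomp Require Import all_classical all_reals all_analysis.

Set Implicit Arguments.
Unset Strict Implicit.
Unset Printing Implicit Defensive.

Import Order.TTheory GRing.Theory Num.Theory.
Import numFieldNormedType.Exports.

Local Open Scope classical_set_scope.
Local Open Scope ring_scope.

(* The value [b_0; b_1, ..., b_m] of s = [:: b_0; ...; b_m].  The convention
   0^-1 = 0 is harmless here: it is never met when b_1, ..., b_m > 0.         *)
Fixpoint cfval (F : fieldType) (s : seq F) : F :=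
  match s with
  | [::] => 0
  | [:: b] => b
  | b :: s' => b + (cfval s')^-1
  end.

Definition convergent (F : fieldType) (a : nat -> int) (m : nat) : F :=
  cfval [seq (a j)%:~R | j <- iota 0 m.+1].

Definition simple_cf_expansion (R : realType) (x : R) (a : nat -> int) : Prop :=
  (forall j, (0 < j)%N -> 1 <= a j) /\ convergent R a @ \oo --> x.

(* A family (z_n)_{n >= 2} is a function z : nat -> int, whose values at 0 and
   1 are never used.  For n = 1 the product is empty, so xs z 1 = 1.          *)
Definition xs (z : nat -> int) (n : nat) : int :=
  \prod_(2 <= j < n.+1) z j ^+ (2 ^ (n - j))%N.

Definition Spartial (R : realType) (z : nat -> int) (n : nat) : R :=
  \sum_(1 <= j < n.+1) ((xs z j)%:~R)^-1.

Definition Ssum (R : realType) (z : nat -> int) : R := limn (Spartial R z).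

Definition ell (n : nat) : nat := (3 * 2 ^ (n - 2) - 1)%N.

(* aseq_from3 z k is the finite sequence a^(k+3), padded with 0 at the indices
   j >= ell (k + 3).                                                          *)
Fixpoint aseq_from3 (z : nat -> int) (k : nat) (j : nat) : int :=
  match k with
  | 0 => nth 0 [:: 1; z 2%N - 1; 1; z 3%N - 1; z 2%N] j
  | k'.+1 =>
      let n := (k' + 3)%N in
      let l := ell n in
      if (j < l)%N then aseq_from3 z k' j
      else if j == l then z n.+1 - 1
      else if j == l.+1 then 1
      else if j == l.+2 then aseq_from3 z k' (l - 1)%N - 1
      else if (j <= 2 * l)%N then aseq_from3 z k' (2 * l - j + 1)%N
      else 0
  end.

(* aseq z n j is a_j^(n), for n >= 3 and j < ell n. *)
Definition aseq (z : nat -> int) (n j : nat) : int := aseq_from3 z (n - 3) j.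

(* Main.v *)
Require Import Defs.
From HB Require Import structures.
From mathcomp Require Import all_boot all_order all_algebra.
From mathcomp Require Import all_classical all_reals all_analysis.
From mathcomp Require Import zify ring lra.

(* Let p/q be the value of [1; t] and q' the denominator of the previous
   convergent.  Since q/q' = [b; ...] is the value of the reversed tail t, the
   block [c - 1; 1, b - 1, ...] equals y = c - q'/q, and
   [1; t, y] = p/q + (-1)^|t| / (q (q y + q')) = p/q + 1/(c q^2) for |t| even.
   As x_(n+1) = z_(n+1) x_n^2, folding the expansion of the n-th partial sum,
   whose denominator is x_n, gives the expansion of the next one.  The same
   formula shows that every longer convergent is within 1/x_n of the n-th
   partial sum. *)

Set Implicit Arguments.
Unset Strict Implicit.
Unset Printing Implicit Defensive.

Import Order.TTheory GRing.Theory Num.Theory.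
Import numFieldNormedType.Exports.

Local Open Scope classical_set_scope.
Local Open Scope ring_scope.

(** Acts on an expansion without a_0, which folding never changes. [behead] drops the first entry b
    of the reversed tail, which 1, b - 1 replaces. *)
Definition fold_cf (A : nzRingType) (c : A) (t : seq A) : seq A :=
  t ++ [:: c - 1, 1, last 0 t - 1 & behead (rev t)].

(** * Continuants as entries of 2x2 matrix products *)

Section CFMatrix.
Variable F : realFieldType.
Implicit Types (s t : seq F) (b c : F).

Definition cfstep b : 'M[F]_2 :=
  \matrix_(i, j) if (i == 0) && (j == 0) then b else (i != j)%:R.

(* cfmx s = [[p, p'], [q, q']], where p / q and p' / q' are the last two
   convergents of s. *)
Definition cfmx s : 'M[F]_2 := foldr (fun b A => cfstep b *m A) 1%:M s.

Lemma mulmx22E (A B : 'M[F]_2) i j :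
  (A *m B) i j = A i 0 * B 0 j + A i 1 * B 1 j.
Proof.
rewrite mxE !big_ord_recl big_ord0 addr0.
by congr (A i _ * B _ j + A i _ * B _ j); apply: val_inj.
Qed.

Lemma tr_cfstep b : (cfstep b)^T = cfstep b.
Proof. by apply/matrixP => i j; rewrite !mxE andbC (eq_sym j i). Qed.

Lemma cfmx_cons0 b s j : cfmx (b :: s) 0 j = b * cfmx s 0 j + cfmx s 1 j.
Proof. by rewrite /= mulmx22E !mxE /= mul1r. Qed.

Lemma cfmx_cons1 b s j : cfmx (b :: s) 1 j = cfmx s 0 j.
Proof. by rewrite /= mulmx22E !mxE /= mul1r mul0r addr0. Qed.

Lemma cfmx_nil : (cfmx [::] 0 0 = 1) * (cfmx [::] 0 1 = 0) *
  (cfmx [::] 1 0 = 0) * (cfmx [::] 1 1 = 1).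
Proof. by rewrite /= !mxE. Qed.

Lemma cfmx_cat s t : cfmx (s ++ t) = cfmx s *m cfmx t.
Proof. by elim: s => [|b s IHs] /=; rewrite ?mul1mx // IHs mulmxA. Qed.

(** Each step matrix is symmetric, so transposing the product reverses its factors. *)
Lemma cfmx_rev s : cfmx (rev s) = (cfmx s)^T.
Proof.
elim: s => [|b s IHs]; first by rewrite /= trmx1.
by rewrite rev_cons -cats1 cfmx_cat IHs /= mulmx1 trmx_mul tr_cfstep.
Qed.

Arguments cfmx : simpl never.

Lemma cfmx_det s :
  cfmx s 0 0 * cfmx s 1 1 - cfmx s 0 1 * cfmx s 1 0 = (-1) ^+ size s.
Proof.
elim: s => [|b s IHs]; first by rewrite !cfmx_nil /= expr0; ring.
rewrite !cfmx_cons0 !cfmx_cons1 [size _]/= exprS -IHs; ring.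
Qed.

Lemma cfmx_bounds s : all (>= 1) s ->
  [/\ 1 <= cfmx s 0 0, 0 <= cfmx s 0 1, 0 <= cfmx s 1 0,
      0 <= cfmx s 1 1 & cfmx s 1 0 <= cfmx s 0 0].
Proof.
elim: s => [_|b s IHs /= /andP[b1 /IHs[h1 h2 h3 h4 h5]]].
  by rewrite !cfmx_nil; split.
rewrite !cfmx_cons0 !cfmx_cons1; split; nra.
Qed.

Lemma cfval_cfmx b s : all (>= 1) s ->
  cfval (b :: s) = cfmx (b :: s) 0 0 / cfmx (b :: s) 1 0.
Proof.
elim: s b => [b _|c s IHs b sge].
  by rewrite cfmx_cons0 cfmx_cons1 !cfmx_nil /=; field.
have /andP[c1 s1] := sge.
have [h1 _ _ _ _] := cfmx_bounds sge.
rewrite (_ : cfval (b :: _) = b + (cfval (c :: s))^-1) // IHs // invf_div.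
rewrite [cfmx (b :: _) 0 0]cfmx_cons0 [cfmx (b :: _) 1 0]cfmx_cons1.
by field; lra.
Qed.

(* The two expansions share the convergent p / q of (b :: s), so by the
   determinant identity they differ by Y' / (q (q Y + q' Y')) with Y' <= Y. *)
Lemma cfval_cat_dist b s t : all (>= 1) s -> all (>= 1) t ->
  `|cfval (b :: s ++ t) - cfval (b :: s)| <= (cfmx s 0 0)^-1.
Proof.
move=> s1 t1; rewrite !cfval_cfmx ?all_cat ?s1 //.
rewrite !cfmx_cons0 !cfmx_cons1 cfmx_cat !mulmx22E.
have [h1 h2 h3 h4 _] := cfmx_bounds s1.
have [k1 _ k3 _ k5] := cfmx_bounds t1.
have := cfmx_det s.
move: (cfmx s 0 0) (cfmx s 0 1) (cfmx s 1 0) (cfmx s 1 1) h1 h2 h3 h4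
  (cfmx t 0 0) (cfmx t 1 0) k1 k3 k5 => q q' r r' h1 h2 h3 h4 Y Y' k1 k3 k5 D.
have den : 0 < q * Y + q' * Y' by nra.
rewrite (_ : _ - _ = (-1) ^+ size s * (Y' / (q * (q * Y + q' * Y')))); last first.
  by rewrite -D; field; apply/andP; split; lra.
rewrite normrMsign ger0_norm; last by apply: divr_ge0 => //; nra.
(* What remains is Y' / (q Y + q' Y') <= 1, true since Y' <= Y and q >= 1. *)
rewrite invfM mulrCA ler_piMr ?invr_ge0 //; first lra.
by rewrite ler_pdivrMr // mul1r; nra.
Qed.

(* [c - 1; 1, b - 1, ...] = c - 1 / [b; ...]. *)
Lemma cfmx_fold c t : t != [::] ->
  cfmx (fold_cf c t) 0 0 = c * cfmx t 0 0 ^+ 2 /\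
  cfmx (fold_cf c t) 1 0 =
    c * cfmx t 0 0 * cfmx t 1 0 + (-1) ^+ size t.
Proof.
case/lastP: t => // u b _; rewrite /fold_cf last_rcons rev_rcons /=.
have D := cfmx_det (rcons u b).
have e1 : cfmx (rev u) 0 0 = cfmx (rcons u b) 0 1.
  by rewrite -[LHS](cfmx_cons1 b) -rev_rcons cfmx_rev mxE.
have e0 : cfmx (rev u) 1 0 = cfmx (rcons u b) 0 0 - b * cfmx (rcons u b) 0 1.
  by rewrite -e1 -[cfmx (rcons u b)]trmxK -cfmx_rev rev_rcons mxE cfmx_cons0; ring.
(* With q, q' the top row of the matrix of t, the appended block has first column (c q - q', q): q'
   cancels in the first product, and the second produces the determinant. *)
by rewrite cfmx_cat; split; rewrite mulmx22E !(cfmx_cons0, cfmx_cons1) e0 e1 -?D; ring.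
Qed.

End CFMatrix.

(** * Folding of lists and the finite sequences a^(n) *)

Lemma map_fold_cf (A B : nzRingType) (f : {rmorphism A -> B}) (c : A) t :
  map f (fold_cf c t) = fold_cf (f c) (map f t).
Proof.
rewrite /fold_cf map_cat /= !rmorphB rmorph1 -map_rev behead_map.
by rewrite -[in RHS](rmorph0 f) last_map.
Qed.

Lemma size_fold_cf (A : nzRingType) (c : A) t : t != [::] ->
  size (fold_cf c t) = (2 * size t + 2)%N.
Proof.
by case: t => // b t _; rewrite size_cat /= size_behead size_rev /=; lia.
Qed.

(** The right-hand side copies the recursive clause of [aseq_from3]; l counts the leading term as
    well. *)
Lemma nth_fold_cf (A : nzRingType) (c a0 : A) t j (l := (size t).+1) :
  t != [::] -> nth 0 (a0 :: fold_cf c t) j =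
    if (j < l)%N then nth 0 (a0 :: t) j
    else if j == l then c - 1
    else if j == l.+1 then 1
    else if j == l.+2 then nth 0 (a0 :: t) (l - 1)%N - 1
    else if (j <= 2 * l)%N then nth 0 (a0 :: t) (2 * l - j + 1)%N
    else 0.
Proof.
move=> t0; rewrite {}/l /fold_cf -cat_cons nth_cat /=; case: ltnP => // lj.
have [i ->] : exists i, j = ((size t).+1 + i)%N.
  by exists (j - (size t).+1)%N; rewrite subnKC.
have -> : ((size t).+1 + i - (size t).+1 = i)%N by lia.
have -> : ((size t).+1 + i == (size t).+1) = (i == 0)%N by lia.
have -> : ((size t).+1 + i == (size t).+1.+1) = (i == 1)%N by lia.
have -> : ((size t).+1 + i == (size t).+1.+2) = (i == 2)%N by lia.
have -> : ((size t).+1 + i <= 2 * (size t).+1)%N = (i <= (size t).+1)%N by lia.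
have -> : (2 * (size t).+1 - ((size t).+1 + i) + 1 = ((size t).+1 - i).+1)%N by lia.
case: i {lj} => [|[|[|i]]] //=.
  by rewrite subSS subn0 -nth_last; case: (t) t0.
(* The test j <= 2 l marks the end of the folded list; beyond it both sides are the default 0. *)
rewrite nth_behead subSS; have [il|il] := leqP i.+3 (size t).+1.
  by rewrite nth_rev.
by rewrite nth_default // size_rev -2!ltnS.
Qed.

Fixpoint cftail (z : nat -> int) (k : nat) : seq int :=
  if k is k'.+1 then fold_cf (z (k' + 3)%N.+1) (cftail z k')
  else [:: z 2%N - 1; 1; z 3%N - 1; z 2%N].

Section Expansion.
Variable z : nat -> int.

Lemma cftail_neq0 k : cftail z k != [::].
Proof.
by case: k => //= k; rewrite -size_eq0 size_cat /= addnS.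
Qed.

Lemma size_cftailS k : size (cftail z k.+1) = (2 * size (cftail z k) + 2)%N.
Proof. exact/size_fold_cf/cftail_neq0. Qed.

Lemma size_cftail k : (size (cftail z k)).+1 = ell (k + 3).
Proof.
elim: k => // k IHk.
rewrite size_cftailS; move: IHk; rewrite /ell.
have -> : (k.+1 + 3 - 2 = (k + 3 - 2).+1)%N by lia.
have p0 : (0 < 2 ^ (k + 3 - 2))%N by rewrite expn_gt0.
rewrite expnS; lia.
Qed.

(** Makes the sign (-1)^|t| in [cfmx_fold] equal to 1 at every stage. *)
Lemma odd_size_cftail k : odd (size (cftail z k)) = false.
Proof.
by case: k => // k; rewrite size_cftailS oddD oddM.
Qed.

Lemma leq_size_cftail k : (k < size (cftail z k))%N.
Proof.
by elim: k => // k IHk; rewrite size_cftailS; lia.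
Qed.

Lemma aseq_from3E k j : aseq_from3 z k j = nth 0 (1 :: cftail z k) j.
Proof.
elim: k j => [|k IHk] j //.
rewrite [cftail _ _]/= nth_fold_cf ?cftail_neq0 // size_cftail /=.
by rewrite !IHk.
Qed.

Lemma prefix_cftail k n : (k <= n)%N ->
  exists t, cftail z n = cftail z k ++ t.
Proof.
elim: n => [|n IHn]; first by rewrite leqn0 => /eqP ->; exists [::]; rewrite cats0.
rewrite leq_eqVlt => /predU1P[->|/IHn[t e]]; first by exists [::]; rewrite cats0.
by rewrite /= /fold_cf e -catA; eexists.
Qed.

Lemma nth_cftail_stable k n j : (k <= n)%N -> (j <= size (cftail z k))%N ->
  nth 0 (1 :: cftail z n) j = nth 0 (1 :: cftail z k) j.
Proof.
by move=> /prefix_cftail[t ->] jk; rewrite -cat_cons nth_cat /= ltnS jk.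
Qed.

(** By [leq_size_cftail], stage j is long enough for its entry j to be final, which makes the limit
    sequence explicit. *)
Definition cflim j : int := nth 0 (1 :: cftail z j) j.

Lemma cflimE k j : (j <= size (cftail z k))%N ->
  cflim j = nth 0 (1 :: cftail z k) j.
Proof.
move=> jk; have [le|/ltnW le] := leqP j k.
  by rewrite (nth_cftail_stable le) // ltnW // leq_size_cftail.
by rewrite /cflim (nth_cftail_stable le).
Qed.

(** * Growth of x_n and positivity of the entries *)

Lemma xsS n : (0 < n)%N -> xs z n.+1 = xs z n ^+ 2 * z n.+1.
Proof.
move=> n0; rewrite /xs big_nat_recr //= subnn expn0 expr1; congr (_ * _).
rewrite -prodrXl; apply: eq_big_nat => j /andP[_ jn].
by rewrite subSn // expnSr exprM.
Qed.

Lemma xs1 : xs z 1 = 1.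
Proof. by rewrite /xs big_geq. Qed.

Hypotheses (hz2 : 3 <= z 2%N) (hz : forall n : nat, (3 <= n)%N -> 2 <= z n).

Lemma cftail_ge1 k : all (>= 1) (cftail z k).
Proof.
have hz3 := hz (leqnn 3).
(* Folding puts the last entry minus 1 inside the list and makes the old head the new last entry, so
   both must stay >= 2. The head is always z_2 - 1, whence z_2 >= 3. *)
suff [] : [/\ all (>= 1) (cftail z k), 2 <= head 0 (cftail z k)
  & 2 <= last 0 (cftail z k)] by [].
elim: k => [|k [IH1 IH2 IH3]]; first by split => /=; lia.
have hk : 2 <= z (k + 3)%N.+1 by apply: hz; lia.
have : (1 < size (cftail z k))%N by case: (k) => // k'; rewrite size_cftailS; lia.
move: IH1 IH2 IH3; rewrite [cftail z k.+1]/=.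
case/lastP: (cftail z k) => // [[|a v] b] //; rewrite /fold_cf last_rcons rev_rcons.
rewrite all_cat all_rcons /= all_rev /= => /and3P[b1 a1 v1] a2 b2 _.
rewrite b1 a1 v1 last_cat /= rev_cons last_rcons; split=> //; lia.
Qed.

Lemma xs_gt0 n : 0 < xs z n.
Proof.
rewrite /xs big_nat; apply: prodr_gt0 => j /andP[j2 _]; apply: exprn_gt0.
case: j j2 => [|[|[|j]]] // _; first lia.
by have := @hz j.+3 isT; lia.
Qed.

Lemma xs_double n : (0 < n)%N -> 2 * xs z n <= xs z n.+1.
Proof.
move=> n0; rewrite xsS //; have := xs_gt0 n.
have : 2 <= z n.+1 by case: n n0 => [|[|n]] // _; [lia|exact: hz].
by nia.
Qed.

(** * Finite expansions as partial sums *)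

Variable R : realType.

Let castR : int -> R := intr.

Lemma SpartialS n : Spartial R z n.+1 = Spartial R z n + ((xs z n.+1)%:~R)^-1.
Proof. by rewrite /Spartial big_nat_recr. Qed.

(** The induction carries the denominator along with the value: as it equals x_n, the correction
    1/(c q^2) with c = z_(n+1) is 1/x_(n+1). *)
Lemma cfmx_cftail k (M := cfmx (map castR (cftail z k))) :
  M 0 0 = (xs z (k + 3))%:~R /\ 1 + M 1 0 / M 0 0 = Spartial R z (k + 3).
Proof.
rewrite {}/M; elim: k => [|k [IH1 IH2]].
  have x2 : xs z 2 = z 2%N by rewrite xsS // xs1 mul1r.
  have x3 : xs z 3 = z 2%N ^+ 2 * z 3%N by rewrite xsS // x2.
  have h2 : (z 2%N)%:~R != 0 :> R by rewrite intr_eq0; lia.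
  have h3 : (z 3%N)%:~R != 0 :> R by rewrite intr_eq0; have := hz (leqnn 3); lia.
  have e : cfmx (map castR (cftail z 0)) 0 0 = (xs z 3)%:~R.
    rewrite [map _ _]/= !(cfmx_cons0, cfmx_cons1) !cfmx_nil /castR x3.
    by rewrite !(rmorphB, rmorphM, rmorphXn, rmorph1) /=; ring.
  rewrite e; split => //; rewrite !SpartialS /Spartial big_geq // xs1 x2 x3.
  rewrite [map _ _]/= !(cfmx_cons0, cfmx_cons1) !cfmx_nil /castR.
  by rewrite !(rmorphB, rmorphM, rmorphXn, rmorph1) /=; field; rewrite h2 h3.
have t0 : map castR (cftail z k) != [::].
  by rewrite -size_eq0 size_map size_eq0 cftail_neq0.
rewrite [cftail z k.+1]/= (map_fold_cf (intr : {rmorphism int -> R})).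
have [-> ->] := cfmx_fold (z (k + 3)%N.+1)%:~R t0.
rewrite size_map -signr_odd odd_size_cftail expr0 addSn SpartialS -IH2.
have k0 : (0 < k + 3)%N by rewrite addn3.
rewrite (xsS k0) rmorphM rmorphXn /= -IH1.
have qn0 : cfmx (map castR (cftail z k)) 0 0 != 0.
  by rewrite IH1 intr_eq0 gt_eqF // xs_gt0.
have zn0 : (z (k + 3)%N.+1)%:~R != 0 :> R.
  by rewrite intr_eq0; have := @hz (k + 3)%N.+1; lia.
split; first by rewrite mulrC.
by rewrite /castR in qn0 *; field; rewrite qn0 zn0.
Qed.

Lemma cftail_castR_ge1 k : all (>= 1) (map castR (cftail z k)).
Proof.
rewrite all_map; have := cftail_ge1 k; apply: sub_all => b /=.
by rewrite /castR ler1z.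
Qed.

Lemma cfval_cftail k : cfval (1 :: map castR (cftail z k)) = Spartial R z (k + 3).
Proof.
rewrite cfval_cfmx ?cftail_castR_ge1 // cfmx_cons0 cfmx_cons1.
have [_ <-] := cfmx_cftail k; have [h _ _ _ _] := cfmx_bounds (cftail_castR_ge1 k).
by field; lra.
Qed.

(** * The infinite expansion and its limit *)

Lemma cflim_ge1 j : (0 < j)%N -> 1 <= cflim j.
Proof.
case: j => // j _; rewrite /cflim /=; have /all_nthP h := cftail_ge1 j.+1.
by apply: h; rewrite (ltn_trans _ (leq_size_cftail _)).
Qed.

(** Such a convergent extends the finite expansion of stage k, whose denominator is x_(k+3), so
    [cfval_cat_dist] applies. *)
Lemma convergent_dist k m : (size (cftail z k) <= m)%N ->
  `|convergent R cflim m - Spartial R z (k + 3)| <= ((xs z (k + 3))%:~R)^-1.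
Proof.
move=> km; have [e _] := cfmx_cftail k.
pose t := [seq castR (cflim j) | j <- iota (size (cftail z k)).+1
  (m - size (cftail z k))].
have -> : convergent R cflim m = cfval (1 :: map castR (cftail z k) ++ t).
  rewrite /convergent (_ : m.+1 = (size (cftail z k)).+1 + (m - size (cftail z k)))%N;
    last lia.
  rewrite iotaD map_cat -cat_cons; congr (cfval (_ ++ _)).
  apply: (@eq_from_nth _ 0) => [|i]; first by rewrite /= !size_map size_iota.
  rewrite size_map size_iota => ik.
  rewrite -[1 :: _]/(map castR (1 :: cftail z k)).
  rewrite (nth_map 0%N) ?size_iota // nth_iota // add0n (nth_map 0) //.
  by rewrite (cflimE (k := k)).
rewrite -cfval_cftail -e; apply: cfval_cat_dist; first exact: cftail_castR_ge1.
apply/allP => b /mapP[j]; rewrite mem_iota => /andP[j0 _] ->.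
rewrite /castR ler1z; apply: cflim_ge1; lia.
Qed.

(** As x_(n+1) >= 2 x_n, counting the last term twice gives a nonincreasing sequence, which starts
    at 1 + 1. *)
Lemma Spartial_le n : Spartial R z n.+1 + ((xs z n.+1)%:~R)^-1 <= 2.
Proof.
elim: n => [|n IHn].
  by rewrite SpartialS /Spartial big_geq // xs1 rmorph1 invr1 add0r.
apply: le_trans IHn; rewrite SpartialS -addrA lerD2l.
have x0 : 0 < (xs z n.+1)%:~R :> R by rewrite ltr0z xs_gt0.
have y0 : 0 < (xs z n.+2)%:~R :> R by rewrite ltr0z xs_gt0.
rewrite -mulr2n -mulr_natl ler_pdivrMr // mulrC ler_pdivlMr //.
by have := xs_double (ltn0Sn n); rewrite -(ler_int R) intrM.
Qed.

Lemma Spartial_nd : nondecreasing_seq (Spartial R z).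
Proof.
apply/nondecreasing_seqP => n; rewrite SpartialS lerDl invr_ge0 ler0z.
by rewrite ltW // xs_gt0.
Qed.

Lemma Spartial_cvg : cvgn (Spartial R z).
Proof.
apply: nondecreasing_is_cvgn; first exact: Spartial_nd.
exists 2 => _ [n _ <-]; apply: (le_trans (Spartial_nd (leqnSn n))).
apply: le_trans (Spartial_le n); rewrite lerDl invr_ge0 ler0z.
by rewrite ltW // xs_gt0.
Qed.

(** The terms are differences of consecutive partial sums of a convergent series. *)
Lemma inv_xs_cvg0 : ((xs z n)%:~R)^-1 @[n --> \oo] --> (0 : R).
Proof.
have S1 : Spartial R z n.+1 @[n --> \oo] --> limn (Spartial R z).
  by rewrite (cvg_shiftS (Spartial R z)); exact: Spartial_cvg.
have S0 : Spartial R z n.+1 - Spartial R z n @[n --> \oo] --> (0 : R).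
  by rewrite -(subrr (limn (Spartial R z))); apply: cvgB S1 Spartial_cvg.
rewrite -cvg_shiftS; move: S0.
by under eq_fun do rewrite SpartialS addrC addKr.
Qed.

Lemma convergent_cflim : convergent R cflim @ \oo --> Ssum R z.
Proof.
apply/cvgrPdist_le => e e0; have e20 : 0 < e / 2 by rewrite divr_gt0.
have [N1 _ h1] := (cvgrPdist_le _ _).1 Spartial_cvg _ e20.
have [N2 _ h2] := (cvgrPdist_le _ _).1 inv_xs_cvg0 _ e20.
(* This k serves both thresholds at once; m must reach the length of stage k for
   [convergent_dist]. *)
pose k := (N1 + N2)%N; exists (size (cftail z k)) => // m /= km.
have k1 : (N1 <= k + 3)%N by rewrite /k; lia.
have k2 : (N2 <= k + 3)%N by rewrite /k; lia.
have d1 := h1 _ k1; have := h2 _ k2; have := convergent_dist km.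
rewrite sub0r normrN => d3 /(le_trans (ler_norm _)) d2.
rewrite -(subrKA (Spartial R z (k + 3))) (splitr e) (le_trans (ler_normD _ _)) //.
by apply: lerD => //; rewrite distrC; apply: le_trans d3 d2.
Qed.

End Expansion.

Theorem theorem2 (R : realType) (z : nat -> int)
    (hz2 : 3 <= z 2%N) (hz : forall n : nat, (3 <= n)%N -> 2 <= z n) :
  cvgn (Spartial R z) /\
  exists a : nat -> int,
    [/\ forall j : nat, \forall n \near \oo, aseq z n j = a j,
        simple_cf_expansion (Ssum R z) a
      & [seq a j | j <- iota 0 7] =
        [:: 1; z 2%N - 1; 1; z 3%N - 1; z 2%N; z 4%N - 1; 1]].
Proof.
split; first exact: Spartial_cvg.
exists (cflim z); split.
(* For n >= j + 3 the sequence a^(n) comes from stage n - 3 >= j, where entry j is already final. *)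
- move=> j; exists (j + 3)%N => // n /= jn; rewrite /aseq aseq_from3E.
  by rewrite (nth_cftail_stable (k := j)) ?(ltnW (leq_size_cftail _ _)) //; lia.
- by split; [exact: cflim_ge1|exact: convergent_cflim].
- by [].
Qed.
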